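(* There exist (separable) Hopf Galois field extensions $K/k$ which are not almost classically Galois but which may be endowed with a Hopf Galois structure such that the Galois correspondence is bijective (one-to-one onto the set of intermediate fields of $K/k$).
   Context: A finite extension $K/k$ is Hopf Galois if there is a finite cocommutative $k$-Hopf algebra $H$ such that $K$ is an $H$-module algebra and the $k$-linear map $j:K\otimes_kH\to\mathrm{End}_k(K)$, $j(s\otimes h)(t)=s(ht)$, is bijective; $H$ with its action is a Hopf Galois structure on $K/k$. For such a structure, with counit $\varepsilon$, the Galois correspondence is the map sending a sub-Hopf algebra $H'$ of $H$ to the intermediate field $K^{H'}=\{x\in K: h\cdot x=\varepsilon(h)x\ \forall h\in H'\}$ of $K/k$; it is always injective, and it is bijective if every intermediate field of $K/k$ is in its image. For $K/k$ finite separable with Galois closure $\widetilde K$, $G=\mathrm{Gal}(\widetilde K/k)$, $G'=\mathrm{Gal}(\widetilde K/K)$, the extension $K/k$ is almost classically Galois if $G'$ has a normal complement in $G$, i.e. a normal subgroup $M$ of $G$ with $M\cap G'=1$ and $MG'=G$. *)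

(* Defs.v *)
From HB Require Import structures.
From mathcomp Require Import all_boot all_order all_algebra.
From mathcomp Require Import all_fingroup all_solvable all_field.

Set Implicit Arguments.
Unset Strict Implicit.
Unset Printing Implicit Defensive.

Import GRing.Theory.
Local Open Scope ring_scope.

(* In coordinates, the tensor product of finite-dimensional spaces is the     *)
(* space of matrices indexed by two bases; [tlift_pure] and [tensor_ext] give *)
(* its universal property, which is all that is used below.                   *)
Section Tensor.
Variable k : fieldType.

Definition tensor (V W : vectType k) : Type :=
  'M[k]_(\dim {:V}, \dim {:W}).

HB.instance Definition _ (V W : vectType k) :=
  Vector.copy (tensor V W) 'M[k]_(\dim {:V}, \dim {:W}).

Definition tpure (V W : vectType k) (v : V) (w : W) : tensor V W :=
  \matrix_(i, j) (coord (vbasis {:V}) i v * coord (vbasis {:W}) j w).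

Definition tlift_fun (V W X : vectType k) (f : V -> W -> X)
    (t : tensor V W) : X :=
  \sum_i \sum_j t i j *: f (vbasis {:V})`_i (vbasis {:W})`_j.

Lemma tlift_fun_is_linear (V W X : vectType k) (f : V -> W -> X) :
  linear (tlift_fun f).
Proof.
move=> a s t; rewrite /tlift_fun scaler_sumr -big_split /=.
apply: eq_bigr => i _; rewrite scaler_sumr -big_split /=.
by apply: eq_bigr => j _; rewrite !mxE scalerDl scalerA.
Qed.

HB.instance Definition _ (V W X : vectType k) (f : V -> W -> X) :=
  GRing.isLinear.Build k (tensor V W) X *:%R (tlift_fun f)
    (tlift_fun_is_linear f).

(* The linear map V (x) W -> X induced by f, meaningful for bilinear f. *)
Definition tlift (V W X : vectType k) (f : V -> W -> X)
  : 'Hom(tensor V W, X) := linfun (tlift_fun f).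

Lemma linear_comb (V X : vectType k) (f : V -> X) (lf : linear f) n
    (a : 'I_n -> k) (x : 'I_n -> V) :
  f (\sum_i a i *: x i) = \sum_i a i *: f (x i).
Proof.
pose fL : {linear V -> X} := HB.pack f (GRing.isLinear.Build k V X *:%R f lf).
transitivity (\sum_i fL (a i *: x i)); first exact: (linear_sum fL).
by apply: eq_bigr => i _; apply: (linearZ_LR fL).
Qed.

Lemma tlift_pure (V W X : vectType k) (f : V -> W -> X) :
    (forall w, linear (f^~ w)) -> (forall v, linear (f v)) ->
  forall v w, tlift f (tpure v w) = f v w.
Proof.
move=> fl fr v w; rewrite lfunE /=.
rewrite {2}(coord_vbasis (memvf v)) (linear_comb (fl w)).
apply: eq_bigr => i _; rewrite {2}(coord_vbasis (memvf w)).
rewrite (linear_comb (fr _)) scaler_sumr.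
by apply: eq_bigr => j _; rewrite mxE scalerA.
Qed.

Lemma tensor_ext (V W X : vectType k) (f g : 'Hom(tensor V W, X)) :
  (forall v w, f (tpure v w) = g (tpure v w)) -> f = g.
Proof.
move=> fg; apply/lfunP => t.
have -> : t = \sum_i \sum_j
    t i j *: tpure (vbasis {:V})`_i (vbasis {:W})`_j.
  apply/matrixP => a b; rewrite summxE (bigD1 a) //= summxE (bigD1 b) //=.
  have fV := basis_free (vbasisP {:V}); have fW := basis_free (vbasisP {:W}).
  rewrite !mxE !coord_free ?eqxx ?mulr1 //.
  rewrite !big1 ?addr0 //.
    move=> i ia; rewrite summxE big1 // => j _.
    by rewrite !mxE !coord_free // (negPf ia) mul0r mulr0.
  by move=> j jb; rewrite !mxE !coord_free // (negPf jb) !mulr0.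
rewrite !linear_sum; apply: eq_bigr => i _.
by rewrite !linear_sum; apply: eq_bigr => j _; rewrite !linearZ /= fg.
Qed.

Definition tmap (V W V' W' : vectType k) (f : V -> V') (g : W -> W')
  : 'Hom(tensor V W, tensor V' W') :=
  tlift (fun v w => tpure (f v) (g w)).

Definition tswap (V W : vectType k) : 'Hom(tensor V W, tensor W V) :=
  tlift (fun v w => tpure w v).

Definition tassoc (U V W : vectType k)
  : 'Hom(tensor (tensor U V) W, tensor U (tensor V W)) :=
  tlift (fun t w => tlift (fun u v => tpure u (tpure v w)) t).

Definition tmul (A B : falgType k) (s t : tensor A B) : tensor A B :=
  tlift (fun a b => tlift (fun c d => tpure (a * c) (b * d)) t) s.

(* The image of U (x) U' in V (x) W. *)
Definition tsub (V W : vectType k) (U : {vspace V}) (U' : {vspace W})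
  : {vspace tensor V W} :=
  <<[seq tpure u w | u <- vbasis U, w <- vbasis U']>>%VS.

End Tensor.

Record hopfAlgebra (k : fieldType) := HopfAlgebra {
  hopf_alg :> falgType k;
  comul : 'Hom(hopf_alg, tensor hopf_alg hopf_alg);
  counit : 'Hom(hopf_alg, k^o);
  antipode : 'End(hopf_alg);
  hopf_coassoc : forall h,
    tassoc hopf_alg hopf_alg hopf_alg (tmap comul id (comul h))
      = tmap id comul (comul h);
  hopf_counit_l : forall h, tlift (fun a b => counit a *: b) (comul h) = h;
  hopf_counit_r : forall h, tlift (fun a b => counit b *: a) (comul h) = h;
  hopf_comul1 : comul 1 = tpure 1 1;
  hopf_comulM : forall g h, comul (g * h) = tmul (comul g) (comul h);
  hopf_counit1 : counit 1 = 1;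
  hopf_counitM : forall g h, counit (g * h) = counit g * counit h;
  hopf_antipode_l : forall h,
    tlift (fun a b => antipode a * b) (comul h) = counit h *: 1;
  hopf_antipode_r : forall h,
    tlift (fun a b => a * antipode b) (comul h) = counit h *: 1
}.

Definition cocommutative (k : fieldType) (H : hopfAlgebra k) : Prop :=
  forall h : H, tswap H H (comul H h) = comul H h.

Definition is_sub_hopf (k : fieldType) (H : hopfAlgebra k)
    (U : {vspace H}) : bool :=
  [&& 1 \in U, (U * U <= U)%VS,
      (comul H @: U <= tsub U U)%VS & (antipode H @: U <= U)%VS].

Definition sub_hopf (k : fieldType) (H : hopfAlgebra k) :=
  {U : {vspace H} | is_sub_hopf U}.

Section HopfGalois.
Variables (k : fieldType) (K : fieldExtType k).

Definition module_algebra (H : hopfAlgebra k) (act : 'Hom(H, 'End(K))) : Prop :=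
  [/\ forall x : K, act 1 x = x,
      forall (g h : H) (x : K), act (g * h) x = act g (act h x),
      forall (h : H) (x y : K),
        act h (x * y) = tlift (fun a b => act a x * act b y) (comul H h)
    & forall h : H, act h 1 = counit H h *: 1].

Definition hopf_galois_map (H : hopfAlgebra k) (act : 'Hom(H, 'End(K)))
  : 'Hom(tensor K H, 'End(K)) :=
  tlift (fun s h => (amull s \o act h)%VF).

Record hopfGaloisStructure := HopfGaloisStructure {
  hgs_hopf :> hopfAlgebra k;
  hgs_act : 'Hom(hgs_hopf, 'End(K));
  hgs_cocommutative : cocommutative hgs_hopf;
  hgs_module_algebra : module_algebra hgs_act;
  hgs_bijective : bijective (hopf_galois_map hgs_act)
}.

Definition hopf_galois : Prop := inhabited hopfGaloisStructure.

Definition fixed_vspace (H : hopfGaloisStructure) (U : {vspace H})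
  : {vspace K} :=
  (\bigcap_(i < \dim U)
     lker (hgs_act H (vbasis U)`_i - counit H (vbasis U)`_i *: \1%VF))%VS.

Lemma fixed_vspaceP (H : hopfGaloisStructure) (U : {vspace H}) (x : K) :
  reflect (forall h, h \in U -> hgs_act H h x = counit H h *: x)
          (x \in fixed_vspace U).
Proof.
have -> : (x \in fixed_vspace U) = [forall i : 'I_(\dim U),
    x \in lker (hgs_act H (vbasis U)`_i - counit H (vbasis U)`_i *: \1%VF)].
  by rewrite memvE; apply/subv_bigcapP/forallP => h i;
    [rewrite memvE h | move=> _; rewrite -memvE h].
apply: (iffP forallP) => [fx h hU | fx i]; last first.
  rewrite memv_ker add_lfunE opp_lfunE scale_lfunE id_lfunE subr_eq0.
  by rewrite fx // vbasis_mem // mem_nth // size_tuple.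
rewrite (coord_vbasis hU) !linear_sum sum_lfunE scaler_suml.
apply: eq_bigr => i _; rewrite !linearZ scale_lfunE /= -scalerA; congr (_ *: _).
have := fx i; rewrite memv_ker add_lfunE opp_lfunE scale_lfunE id_lfunE.
by rewrite subr_eq0 => /eqP.
Qed.

Lemma fixed_vspace_is_aspace (H : hopfGaloisStructure) (U : sub_hopf H) :
  is_aspace (fixed_vspace (val U)).
Proof.
case: U => U /= /and4P[_ _ sU _].
have [_ _ actM act1] := hgs_module_algebra H.
apply/andP; split.
  by apply/has_algid1/fixed_vspaceP => h _; apply: act1.
apply/prodvP => x y /fixed_vspaceP fx /fixed_vspaceP fy.
apply/fixed_vspaceP => h hU; rewrite actM.
pose F (a b : H) : K := hgs_act H a x * hgs_act H b y.
pose G (a b : H) := (counit H a * counit H b) *: (x * y).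
have Flin a b : tlift F (tpure a b) = F a b.
  apply: tlift_pure => {a b} [b c a a'|a c b b'].
    by rewrite /F linearP add_lfunE scale_lfunE mulrDl -scalerAl.
  by rewrite /F linearP add_lfunE scale_lfunE mulrDr -scalerAr.
have Glin a b : tlift G (tpure a b) = G a b.
  apply: tlift_pure => {a b} [b c a a'|a c b b'].
    by rewrite /G linearP mulrDl scalerDl -scalerAl [in RHS]scalerA.
  by rewrite /G linearP mulrDr scalerDl -scalerAr [in RHS]scalerA.
have FG : (tsub U U <= lker (tlift F - tlift G))%VS.
  apply/span_subvP => _ /allpairsP[[a b] /= [aU bU ->]].
  rewrite memv_ker add_lfunE opp_lfunE Flin Glin /F /G.
  rewrite fx ?fy ?vbasis_mem //.
  by rewrite -scalerAl -scalerAr scalerA subrr.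
have := subvP FG _ (subvP sU _ (memv_img (comul H) hU)).
rewrite memv_ker add_lfunE opp_lfunE subr_eq0 => /eqP ->.
rewrite -[in RHS](hopf_counit_l h) !lfunE /= /tlift_fun linear_sum scaler_suml.
apply: eq_bigr => i _; rewrite linear_sum scaler_suml.
apply: eq_bigr => j _; rewrite !linearZ /= scalerA; congr (_ *: _).
by rewrite mulrC.
Qed.

(* A map of types from the sub-Hopf algebras of H to the intermediate fields; *)
(* both sides are subtypes of {vspace _}, so equality is extensional.         *)
Definition galois_correspondence (H : hopfGaloisStructure) (U : sub_hopf H)
  : {subfield K} := ASpace (fixed_vspace_is_aspace U).

Definition galois_closure (L : splittingFieldType k) (iota : 'AHom(K, L))
  : Prop :=
  galois 1 {:L} /\
  forall E : {subfield L}, (limg iota <= E)%VS -> galois 1 E -> E = {:L}%AS.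

(* To be used with [galois_closure iota]; Galois closures of K/k being        *)
(* isomorphic over K, the property then depends only on K/k.                  *)
Definition almost_classically_galois
    (L : splittingFieldType k) (iota : 'AHom(K, L)) : Prop :=
  exists M : {group gal_of {:L}},
    [/\ (M <| 'Gal({:L} / 1))%g,
        (M :&: 'Gal({:L} / limg iota) = 1)%g
      & (M * 'Gal({:L} / limg iota) = 'Gal({:L} / 1))%g].

End HopfGalois.

(* Main.v *)
Require Import Defs.
From HB Require Import structures.
From mathcomp Require Import all_boot all_order all_algebra.
From mathcomp Require Import all_fingroup all_solvable all_field.
From mathcomp Require Import ring.

(** The example is K = Q(a) with a^10 = 5. Its Galois closure is L = Q(a, w),
    w a primitive fifth root of unity, and the point is that K already contains
    sqrt 5 = a^5, which lies in the cyclotomic field Q(w): the group of L/Q is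
    the Frobenius group of order 20 and not the affine group of order 40, and
    the translation group Z/10 that would be a normal complement is missing.

    A Hopf Galois structure on K. The lines Q a^i grade K by Z/10, so the Hopf
    algebra H = Q^(Z/10) of functions on Z/10 acts on K, h multiplying a^i by
    h(i). This makes sense for every field with a one-dimensional grading by a
    finite abelian group A, and is then always a Hopf Galois structure: the map
    K (x) H -> End(K) has the explicit inverse sending phi to the sum over x of
    (phi(b_x) / b_x) (x) delta_x, where b_x spans the component of degree x
    ([gact_bijective]).

    Its Galois correspondence. A sub-Hopf algebra of k^A is stable under
    translations and, as a unital subalgebra of a function algebra, consists of
    all the functions which do not separate points that it does not separate
    ([subalg_memP]). So it is the algebra of functions invariant under a
    subgroup B of A, and its fixed field is the span of the b_x, x in B. The
    correspondence is therefore bijective as soon as every intermediate field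
    is spanned by some of the b_x ([graded_correspondence_bijective]).

    Intermediate fields of a radical extension. Let a^n = c be in k, [k(a) : k]
    = n, and let F be an intermediate field, m = [k(a) : F]. The norm of a over
    F is, up to sign, a product of m of the n-th roots of c, hence its n-th
    power is c^m = (a^m)^n: it differs from a^m by an n-th root of unity of
    k(a). If these all lie in k, then a^m is in F and a degree count gives
    F = k(a^m), which is spanned by powers of a ([radical_subfieldE]).
    The same norm, taken over F = Q, gives [Q(a) : Q] = 10, by comparing the
    exponents of 5.

    The Galois group. Let s = 1 + 2 (w + w^4), a square root of 5, so that
    a^5 = s or - s. An automorphism g of L with g(a) = - a sends s to - s, so
    g(w) is w^2 or w^3 and g(g(w)) = w^-1: thus g^2 is a nontrivial element of
    G' = Gal(L/K). This has two consequences. First, the only tenth roots of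
    unity in K are 1 and -1, since g^2 fixes K and inverts w. Secondly, an
    element of G' fixes s, so it maps w to w or w^-1 and has square 1; if M
    were a normal complement of G' in G = Gal(L/Q), squares of elements of G
    would lie in M because G/M is isomorphic to G', and g^2 would be a
    nontrivial element of M and of G' ([normal_complement_sqr]). *)

Set Implicit Arguments.
Unset Strict Implicit.
Unset Printing Implicit Defensive.

Import GRing.Theory Num.Theory.
Local Open Scope ring_scope.

(** * Bilinear maps on tensor products *)

Section TensorBilinear.
Variable k : fieldType.

Lemma tpure_linear_l (V W : vectType k) (w : W) :
  linear (fun v : V => tpure v w).
Proof.
by move=> c u v; apply/matrixP=> i j; rewrite !mxE linearP mulrDl mulrA.
Qed.

Lemma tpure_linear_r (V W : vectType k) (v : V) : linear (@tpure k V W v).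
Proof.
by move=> c u w; apply/matrixP=> i j; rewrite !mxE linearP mulrDr mulrCA.
Qed.

Lemma sum_of_linear (V X : vectType k) (f : V -> X) (I : finType) (v : I -> V) :
  linear f -> f (\sum_i v i) = \sum_i f (v i).
Proof.
move=> lf; pose linf := GRing.isLinear.Build k V X *:%R f lf.
pose fL : {linear V -> X} := HB.pack f linf.
exact: (linear_sum fL).
Qed.

Lemma scale_of_linear (V X : vectType k) (f : V -> X) c v :
  linear f -> f (c *: v) = c *: f v.
Proof.
move=> lf; pose linf := GRing.isLinear.Build k V X *:%R f lf.
pose fL : {linear V -> X} := HB.pack f linf.
exact: (linearZ_LR fL).
Qed.

Lemma tpure_suml (V W : vectType k) (I : finType) (v : I -> V) (w : W) :
  tpure (\sum_i v i) w = \sum_i tpure (v i) w.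
Proof. exact: (sum_of_linear _ (tpure_linear_l w)). Qed.

Lemma tpure_sumr (V W : vectType k) (I : finType) (v : V) (w : I -> W) :
  tpure v (\sum_i w i) = \sum_i tpure v (w i).
Proof. exact: (sum_of_linear _ (tpure_linear_r v)). Qed.

Lemma tpureZl (V W : vectType k) c (v : V) (w : W) :
  tpure (c *: v) w = c *: tpure v w.
Proof. exact: (scale_of_linear _ _ (tpure_linear_l w)). Qed.

Lemma tpureZr (V W : vectType k) c (v : V) (w : W) :
  tpure v (c *: w) = c *: tpure v w.
Proof. exact: (scale_of_linear _ _ (tpure_linear_r v)). Qed.

Lemma tassoc_pure (U V W : vectType k) (t : tensor U V) (w : W) :
  tassoc U V W (tpure t w) = tlift (fun u v => tpure u (tpure v w)) t.
Proof.
rewrite /tassoc tlift_pure // => [w' c a b|t' c a b]; first by rewrite linearP.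
transitivity ((c *: tlift (fun u v => tpure u (tpure v a)) +
   tlift (fun u v => tpure u (tpure v b))) t'); last first.
  by rewrite add_lfunE scale_lfunE.
congr (fun_of_lfun _ t'); apply: tensor_ext => u v.
rewrite add_lfunE scale_lfunE !tlift_pure => *; do ?[move=> ? ? ?];
 by rewrite ?(tpure_linear_l, tpure_linear_r).
Qed.

Lemma tmul_linear_l (B C : falgType k) (t : tensor B C) : linear (fun s => tmul s t).
Proof. by move=> c a b; rewrite /tmul linearP. Qed.

Lemma tmul_pure (B C : falgType k) (a b : B) (c d : C) :
  tmul (tpure a c) (tpure b d) = tpure (a * b) (c * d).
Proof.
have F_l u v : linear (fun b' : B => tpure (u * b') (v : C)).
  by move=> e x y; rewrite mulrDr -scalerAr tpure_linear_l.
have F_r u v : linear (fun b' : C => tpure (v : B) (u * b')).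
  by move=> e x y; rewrite mulrDr -scalerAr tpure_linear_r.
have F0 u v b' d' : tlift (fun b d => tpure (u * b : B) (v * d : C)) (tpure b' d')
   = tpure (u * b') (v * d') by rewrite tlift_pure.
rewrite /tmul tlift_pure ?F0 // => [w e x y|w e x y].
  transitivity ((e *: tlift (fun b d => tpure (x * b) (w * d)) +
     tlift (fun b d => tpure (y * b) (w * d))) (tpure b d)).
    by rewrite add_lfunE scale_lfunE !F0 mulrDl -scalerAl tpure_linear_l.
  by rewrite add_lfunE scale_lfunE.
by rewrite !F0 mulrDl -scalerAl tpure_linear_r.
Qed.

Lemma tmul_linear_r (B C : falgType k) (s : tensor B C) : linear (tmul s).
Proof.
move=> c a b; rewrite /tmul !lfunE /= /tlift_fun scaler_sumr -big_split /=.
apply: eq_bigr => i _; rewrite scaler_sumr -big_split /=.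
by apply: eq_bigr => j _; rewrite linearP scalerDr !scalerA mulrC.
Qed.

Lemma mem_tsub (V W : vectType k) (U : {vspace V}) (U' : {vspace W}) v w :
  v \in U -> w \in U' -> tpure v w \in tsub U U'.
Proof.
move=> vU wU; rewrite (coord_vbasis vU) tpure_suml.
apply: memv_suml => i _; rewrite tpureZl memvZ //.
rewrite (coord_vbasis wU) tpure_sumr.
apply: memv_suml => j _; rewrite tpureZr memvZ //.
by apply: memv_span; apply: allpairs_f; apply: mem_nth; rewrite size_tuple.
Qed.

End TensorBilinear.

(** * The Hopf algebra of functions on a finite abelian group *)

(** A copy of the finite function type, so that it can carry the pointwise
    algebra structure over [k]. *)
Definition funAlg (A : finZmodType) (k : fieldType) : Type := {ffun A -> k^o}.

Section FunAlg.
Variables (A : finZmodType) (k : fieldType).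
Local Notation H := (funAlg A k).

HB.instance Definition _ := Vector.copy H {ffun A -> k^o}.
HB.instance Definition _ := GRing.PzRing.copy H {ffun A -> k^o}.

Lemma funAlg1_neq0 : (1 : H) != 0.
Proof. by apply/eqP => /ffunP/(_ 0)/eqP; rewrite !ffunE oner_eq0. Qed.

HB.instance Definition _ := GRing.PzSemiRing_isNonZero.Build H funAlg1_neq0.

Lemma funAlg_scalerAl (c : k) (g h : H) : c *: (g * h) = (c *: g) * h.
Proof. by apply/ffunP=> x; rewrite !ffunE scalerAl. Qed.

Lemma funAlg_scalerAr (c : k) (g h : H) : c *: (g * h) = g * (c *: h).
Proof. by apply/ffunP=> x; rewrite !ffunE scalerAr. Qed.

HB.instance Definition _ := GRing.Lmodule_isLalgebra.Build k H funAlg_scalerAl.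
HB.instance Definition _ := GRing.Lalgebra_isAlgebra.Build k H funAlg_scalerAr.
HB.instance Definition _ := Algebra_isFalgebra.Build k H.

End FunAlg.

Section FunHopf.
Variables (A : finZmodType) (k : fieldType).
Local Notation H := (funAlg A k).
Implicit Types (g h : H) (x y z : A).

Definition delta x : H := [ffun y => (y == x)%:R].
Definition shift x h : H := [ffun y => h (x + y)].

Lemma funAlgZE (c : k) h x : (c *: h) x = c * h x.
Proof. exact: ffunE. Qed.
Lemma funAlgME g h x : (g * h) x = g x * h x.
Proof. exact: ffunE. Qed.
Lemma funAlg1E x : (1 : H) x = 1.
Proof. exact: ffunE. Qed.
Lemma funAlgDE g h x : (g + h) x = g x + h x.
Proof. exact: ffunE. Qed.
Lemma funAlgBE g h x : (g - h) x = g x - h x.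
Proof. by rewrite /GRing.add /= !ffunE. Qed.
Lemma funAlg_sumE (I : finType) (F : I -> H) x : (\sum_i F i) x = \sum_i F i x.
Proof. exact: (sum_ffunE (I := I) _ _ (F : I -> {ffun A -> k^o})). Qed.

Lemma sum_deltaZ (X : vectType k) (a : A) (F : A -> X) :
  \sum_x delta x a *: F x = F a.
Proof.
rewrite (bigD1 a) //= ffunE eqxx scale1r big1 ?addr0 // => x xa.
by rewrite ffunE eq_sym (negPf xa) scale0r.
Qed.

Lemma sum_delta h : \sum_x h x *: delta x = h.
Proof.
apply/ffunP=> y; rewrite funAlg_sumE -[RHS](sum_deltaZ y (fun x => h x : k^o)).
by apply: eq_bigr => x _; rewrite funAlgZE mulrC.
Qed.

Lemma funAlgM_delta x h : delta x * h = h x *: delta x.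
Proof.
apply/ffunP=> y; rewrite funAlgME funAlgZE ffunE.
by case: eqP => [->|_]; rewrite ?mul1r ?mulr1 // mul0r mulr0.
Qed.

Lemma shift_linear x : linear (shift x).
Proof. by move=> c g h; apply/ffunP=> y; rewrite !(ffunE, funAlgDE, funAlgZE). Qed.

HB.instance Definition _ x :=
  GRing.isLinear.Build k H H *:%R (shift x) (shift_linear x).

Lemma shift0 h : shift 0 h = h.
Proof. by apply/ffunP=> y; rewrite ffunE add0r. Qed.

Lemma shiftD x y h : shift x (shift y h) = shift (x + y) h.
Proof. by apply/ffunP=> z; rewrite !ffunE addrCA addrA. Qed.

Lemma shift_delta x y : shift x (delta y) = delta (y - x).
Proof. by apply/ffunP=> z; rewrite !ffunE [z == _]eq_sym subr_eq eq_sym addrC. Qed.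

Lemma shiftM x g h : shift x (g * h) = shift x g * shift x h.
Proof. by apply/ffunP=> y; rewrite !(ffunE, funAlgME). Qed.

(** The usual comultiplication, that of [(x, y) |-> h (x + y)] in the function
    algebra of [A * A], with the second variable summed up: the single sum
    reduces the Hopf algebra axioms to the composition of translations. *)
Definition fun_comul_fun h : tensor H H := \sum_x tpure (delta x) (shift x h).

Lemma fun_comul_fun_linear : linear fun_comul_fun.
Proof.
move=> c g h; rewrite /fun_comul_fun scaler_sumr -big_split /=.
by apply: eq_bigr => x _; rewrite shift_linear tpure_linear_r.
Qed.
HB.instance Definition _ :=
  GRing.isLinear.Build k H (tensor H H) *:%R fun_comul_fun fun_comul_fun_linear.

Definition fun_comul : 'Hom(H, tensor H H) := linfun fun_comul_fun.
Lemma fun_comulE h : fun_comul h = \sum_x tpure (delta x) (shift x h).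
Proof. by rewrite lfunE. Qed.

Definition fun_counit_fun h : k^o := h 0.
Lemma fun_counit_linear : linear fun_counit_fun.
Proof. by move=> c g h; rewrite /fun_counit_fun funAlgDE funAlgZE. Qed.
HB.instance Definition _ :=
  GRing.isLinear.Build k H k^o *:%R fun_counit_fun fun_counit_linear.
Definition fun_counit : 'Hom(H, k^o) := linfun fun_counit_fun.
Lemma fun_counitE h : fun_counit h = h 0.
Proof. by rewrite lfunE. Qed.

Definition fun_antipode_fun h : H := [ffun x => h (- x)].
Lemma fun_antipode_linear : linear fun_antipode_fun.
Proof. by move=> c g h; apply/ffunP=> x; rewrite !(ffunE, funAlgDE, funAlgZE). Qed.
HB.instance Definition _ :=
  GRing.isLinear.Build k H H *:%R fun_antipode_fun fun_antipode_linear.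
Definition fun_antipode : 'End(H) := linfun fun_antipode_fun.
Lemma fun_antipodeE h x : fun_antipode h x = h (- x).
Proof. by rewrite lfunE /= ffunE. Qed.

Lemma tlift_comul (X : vectType k) (F : H -> H -> X) h :
  (forall w, linear (F^~ w)) -> (forall v, linear (F v)) ->
  tlift F (fun_comul h) = \sum_x F (delta x) (shift x h).
Proof.
move=> Fl Fr; rewrite fun_comulE linear_sum /=.
by apply: eq_bigr => x _; rewrite tlift_pure.
Qed.

(** Both sides are the sum of [delta u (x) delta v (x) shift (u + v) h]; on the
    left the first two factors come from translating [delta x], so that [x]
    stands for [u + v]. *)
Lemma fun_coassoc h :
  tassoc H H H (tmap fun_comul id (fun_comul h)) = tmap id fun_comul (fun_comul h).
Proof.
transitivity (\sum_x \sum_u tpure (delta u) (tpure (delta (x - u)) (shift x h))).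
  rewrite tlift_comul; last 2 first.
  - by move=> w c a b; rewrite linearP tpure_linear_l.
  - by move=> v c a b; rewrite tpure_linear_r.
  rewrite linear_sum; apply: eq_bigr => x _.
  rewrite /= tassoc_pure tlift_comul; last 2 first.
  - by move=> w c a b; rewrite tpure_linear_l.
  - by move=> w c a b; rewrite tpure_linear_l tpure_linear_r.
  by apply: eq_bigr => u _; rewrite shift_delta.
rewrite exchange_big tlift_comul /=; last 2 first.
- by move=> w c a b; rewrite tpure_linear_l.
- by move=> w c a b; rewrite linearP tpure_linear_r.
apply: eq_bigr => u _; rewrite fun_comulE tpure_sumr.
rewrite (reindex_inj (addIr u)) /=; apply: eq_bigr => x _.
by rewrite addrK shiftD.
Qed.

Lemma fun_counit_l h : tlift (fun a b => fun_counit a *: b) (fun_comul h) = h.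
Proof.
rewrite tlift_comul => [|w c a b|v c a b].
- under eq_bigr do rewrite fun_counitE.
  by rewrite (sum_deltaZ 0 (fun x => shift x h)) shift0.
- by rewrite linearP scalerDl scalerA.
- by rewrite scalerDr !scalerA mulrC.
Qed.

Lemma fun_counit_r h : tlift (fun a b => fun_counit b *: a) (fun_comul h) = h.
Proof.
rewrite tlift_comul => [|w c a b|v c a b].
- under eq_bigr do rewrite fun_counitE ffunE addr0.
  exact: sum_delta.
- by rewrite scalerDr !scalerA mulrC.
- by rewrite linearP scalerDl scalerA.
Qed.

Lemma sum_delta1 : \sum_x delta x = 1.
Proof.
by rewrite -[RHS]sum_delta; apply: eq_bigr => x _; rewrite funAlg1E scale1r.
Qed.

Lemma shift1 x : shift x 1 = 1.
Proof. by apply/ffunP=> y; rewrite !ffunE. Qed.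

Lemma fun_comul1 : fun_comul 1 = tpure 1 1.
Proof.
rewrite fun_comulE -{2}sum_delta1 tpure_suml.
by apply: eq_bigr => x _; rewrite shift1.
Qed.

Lemma fun_comulM g h : fun_comul (g * h) = tmul (fun_comul g) (fun_comul h).
Proof.
rewrite !fun_comulE (sum_of_linear _ (tmul_linear_l _)).
apply: eq_bigr => x _; rewrite (sum_of_linear _ (tmul_linear_r _)).
under eq_bigr do
  rewrite tmul_pure funAlgM_delta tpureZl ffunE eq_sym.
rewrite (bigD1 x) //= eqxx scale1r big1 ?addr0 ?shiftM // => y yx.
by rewrite (negPf yx) scale0r.
Qed.

Lemma fun_counit1 : fun_counit 1 = 1.
Proof. by rewrite fun_counitE funAlg1E. Qed.

Lemma fun_counitM g h : fun_counit (g * h) = fun_counit g * fun_counit h.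
Proof. by rewrite !fun_counitE funAlgME. Qed.

Lemma fun_antipode_l h :
  tlift (fun a b => fun_antipode a * b) (fun_comul h) = fun_counit h *: 1.
Proof.
rewrite tlift_comul => [|w c a b|v c a b].
- apply/ffunP=> y; rewrite funAlg_sumE fun_counitE funAlgZE funAlg1E mulr1.
  under eq_bigr do rewrite funAlgME fun_antipodeE.
  by rewrite (sum_deltaZ (- y) (fun x => shift x h y)) ffunE addNr.
- by rewrite linearP mulrDl scalerAl.
- by rewrite mulrDr scalerAr.
Qed.

Lemma fun_antipode_r h :
  tlift (fun a b => a * fun_antipode b) (fun_comul h) = fun_counit h *: 1.
Proof.
rewrite tlift_comul => [|w c a b|v c a b].
- apply/ffunP=> y; rewrite funAlg_sumE fun_counitE funAlgZE funAlg1E mulr1.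
  under eq_bigr do rewrite funAlgME fun_antipodeE.
  by rewrite (sum_deltaZ y (fun x => shift x h (- y))) ffunE subrr.
- by rewrite mulrDl scalerAl.
- by rewrite linearP mulrDr scalerAr.
Qed.

(** The dual of the group algebra of [A]. *)
Definition funHopf : hopfAlgebra k :=
  HopfAlgebra fun_coassoc fun_counit_l fun_counit_r fun_comul1 fun_comulM
    fun_counit1 fun_counitM fun_antipode_l fun_antipode_r.

Lemma funHopf_cocommutative : cocommutative funHopf.
Proof.
move=> h; rewrite /tswap /= tlift_comul => [|w c a b|v c a b].
- transitivity (\sum_x \sum_y h (x + y) *: tpure (delta y) (delta x)).
    apply: eq_bigr => x _.
    rewrite -{1}[shift x h]sum_delta tpure_suml.
    by apply: eq_bigr => y _; rewrite tpureZl ffunE.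
  rewrite exchange_big fun_comulE; apply: eq_bigr => y _ /=.
  rewrite -{1}[shift y h]sum_delta tpure_sumr.
  apply: eq_bigr => x _.
  by rewrite tpureZr ffunE addrC.
- by rewrite tpure_linear_r.
- by rewrite tpure_linear_l.
Qed.

End FunHopf.

(** * Fields graded by a finite abelian group *)

Section GradedField.
Variables (A : finZmodType) (k : fieldType) (K : fieldExtType k) (b : A -> K).
Hypothesis b_basis : basis_of {:K} (codom b).
Hypothesis b0 : b 0 = 1.
Hypothesis bM : forall x y, exists c, b x * b y = c *: b (x + y).
Local Notation H := (funHopf A k).
Implicit Types (g h : H) (x y z : A) (u v : K).

Definition gcoef x v : k := coord (codom_tuple b) (enum_rank x) v.

Lemma gcoef_linear x : linear (gcoef x : K -> k^o).
Proof. by move=> c u v; rewrite /gcoef linearP. Qed.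

Lemma gcoef_basis x y : gcoef x (b y) = (x == y)%:R.
Proof.
have fb : free (codom_tuple b) by apply: basis_free b_basis.
have -> : b y = (codom_tuple b)`_(enum_rank y) by rewrite nth_codom enum_rankK.
by rewrite /gcoef coord_free // (inj_eq enum_rank_inj) eq_sym.
Qed.

Lemma gcoef_sum v : v = \sum_x gcoef x v *: b x.
Proof.
have vb: v \in <<codom_tuple b>>%VS.
  by move: (memvf v); rewrite -(span_basis b_basis).
rewrite {1}(coord_span vb) (reindex (@enum_rank A)) /=; last first.
  exact: (onW_bij _ (@enum_rank_bij A)).
by apply: eq_bigr => x _; rewrite nth_codom enum_rankK.
Qed.

Lemma graded_basis_neq0 x : b x != 0.
Proof.
apply/eqP => bx; have := gcoef_basis x x; rewrite bx eqxx /gcoef linear0.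
by move/eqP; rewrite eq_sym oner_eq0.
Qed.

Lemma graded_lfun_ext (V : vectType k) (f g : 'Hom(K, V)) :
  (forall x, f (b x) = g (b x)) -> f = g.
Proof.
move=> fg; apply/lfunP => v; rewrite (gcoef_sum v) !linear_sum.
by apply: eq_bigr => x _; rewrite !linearZ /= fg.
Qed.

Definition gact_fun h v : K := \sum_x (h x * gcoef x v) *: b x.

Lemma gact_fun_linear h : linear (gact_fun h).
Proof.
move=> c u v; rewrite /gact_fun scaler_sumr -big_split /=.
apply: eq_bigr => x _; rewrite gcoef_linear scalerA -scalerDl mulrDr.
by rewrite mulrCA.
Qed.
HB.instance Definition _ h :=
  GRing.isLinear.Build k K K *:%R (gact_fun h) (gact_fun_linear h).

Definition gact_lfun h : 'End(K) := linfun (gact_fun h).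

Lemma gact_lfun_linear : linear gact_lfun.
Proof.
move=> c g h; apply/lfunP => v.
rewrite add_lfunE scale_lfunE !lfunE /= /gact_fun scaler_sumr -big_split /=.
apply: eq_bigr => x _; rewrite scalerA -scalerDl.
by rewrite funAlgDE funAlgZE mulrDl mulrA.
Qed.
HB.instance Definition _ :=
  GRing.isLinear.Build k H 'End(K) *:%R gact_lfun gact_lfun_linear.
Definition gact : 'Hom(H, 'End(K)) := linfun gact_lfun.

Lemma gactE h v : gact h v = \sum_x (h x * gcoef x v) *: b x.
Proof. by rewrite !lfunE. Qed.

Lemma gact_basis h x : gact h (b x) = h x *: b x.
Proof.
rewrite gactE (bigD1 x) //= gcoef_basis eqxx mulr1 big1 ?addr0 // => y yx.
by rewrite gcoef_basis (negPf yx) mulr0 scale0r.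
Qed.

Lemma gact_delta x v : gact (delta k x) v = gcoef x v *: b x.
Proof.
rewrite gactE (bigD1 x) //= ffunE eqxx mul1r big1 ?addr0 // => y yx.
by rewrite ffunE (negPf yx) mul0r scale0r.
Qed.

(** On [b x * b y], of degree [x + y], only the term of index [x] of the
    comultiplication survives, and its second factor acts on [b y] as
    [h (x + y)]. *)
Lemma gact_mulP h u v :
  gact h (u * v) = tlift (fun a b => gact a u * gact b v) (comul H h).
Proof.
rewrite tlift_comul => [|w c a a'|w c a a']; last 2 first.
- by rewrite linearP add_lfunE scale_lfunE mulrDl scalerAl.
- by rewrite linearP add_lfunE scale_lfunE mulrDr scalerAr.
rewrite {1}(gcoef_sum u) mulr_suml linear_sum; apply: eq_bigr => x _ /=.
rewrite gact_delta {1}(gcoef_sum v) mulr_sumr linear_sum gactE mulr_sumr.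
apply: eq_bigr => y _ /=; rewrite -!scalerAl -!scalerAr.
have [c ->] := bM x y; rewrite !linearZ /= gact_basis ffunE !scalerA.
by congr (_ *: _); rewrite mulrC -!mulrA; congr (_ * _); rewrite mulrC mulrA.
Qed.

Lemma gact_module_algebra : module_algebra gact.
Proof.
split=> [v|g h v|h u v|h].
- rewrite gactE [RHS]gcoef_sum; apply: eq_bigr => x _.
  by rewrite funAlg1E mul1r.
- rewrite -comp_lfunE; congr (fun_of_lfun _ v); apply: graded_lfun_ext => x.
  by rewrite comp_lfunE !gact_basis linearZ /= gact_basis scalerA funAlgME mulrC.
- exact: gact_mulP.
- by rewrite -b0 gact_basis /= fun_counitE.
Qed.

(** The operators [amull s \o gact (delta k x)], which send [b x] to [s * b x]
    and the other basis vectors to 0, fill [End K] because the [b x] are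
    invertible. *)
Lemma gact_bijective : bijective (hopf_galois_map gact).
Proof.
pose inv (f : 'End(K)) : tensor K H :=
  \sum_x tpure (f (b x) / b x) (delta k x).
have map_pure s h : hopf_galois_map gact (tpure s h) = (amull s \o gact h)%VF.
  rewrite /hopf_galois_map tlift_pure // => [w|v] c u u'.
    by rewrite linearP comp_lfunDl comp_lfunZl.
  by rewrite linearP comp_lfunDr comp_lfunZr.
have inv_lin : linear inv.
  move=> c f g; rewrite /inv scaler_sumr -big_split; apply: eq_bigr => x _ /=.
  by rewrite add_lfunE scale_lfunE mulrDl -scalerAl tpure_linear_l.
pose invL : {linear 'End(K) -> tensor K H} :=
  HB.pack inv (GRing.isLinear.Build _ _ _ *:%R inv inv_lin).
exists inv => [t|f].
  have -> : inv (hopf_galois_map gact t) =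
      (linfun invL \o hopf_galois_map gact)%VF t by rewrite comp_lfunE [RHS]lfunE.
  rewrite -[RHS]id_lfunE; congr (fun_of_lfun _ t); apply: tensor_ext => s h.
  rewrite comp_lfunE map_pure [LHS]lfunE /= /inv id_lfunE.
  rewrite -[in RHS](sum_delta h) tpure_sumr.
  apply: eq_bigr => x _.
  rewrite comp_lfunE gact_basis lfunE /= -scalerAr -scalerAl mulfK ?graded_basis_neq0 //.
  by rewrite tpureZl tpureZr.
apply: graded_lfun_ext => y; rewrite /inv linear_sum sum_lfunE /=.
rewrite (bigD1 y) //= map_pure comp_lfunE gact_basis ffunE eqxx scale1r lfunE /=.
rewrite divfK ?graded_basis_neq0 // big1 ?addr0 // => x xy.
by rewrite map_pure comp_lfunE gact_basis ffunE eq_sym (negPf xy) scale0r linear0.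
Qed.

Definition gradedHGS : hopfGaloisStructure K :=
  HopfGaloisStructure (@funHopf_cocommutative A k) gact_module_algebra gact_bijective.

End GradedField.

(** * Sub-Hopf algebras of the function algebra *)

Section SubHopf.
Variables (A : finZmodType) (k : fieldType).
Local Notation H := (funHopf A k).
Implicit Types (U : {vspace H}) (h u : H) (x y z : A).

(** Evaluating the first tensor factor at [x] maps [comul h] to [shift x h] and
    [tsub U U] into [U]. *)
Lemma sub_hopf_shift U x h : is_sub_hopf U -> h \in U -> shift x h \in U.
Proof.
case/and4P=> _ _ sU _ hU.
pose slice := tlift (fun u w : H => u x *: w).
have slice_pure u w : slice (tpure u w) = u x *: w.
  rewrite /slice tlift_pure // => [w' c a a'|a c w' w''].
    by rewrite funAlgDE funAlgZE scalerDl scalerA.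
  by rewrite scalerDr !scalerA mulrC.
have sliceU : (slice @: tsub U U <= U)%VS.
  rewrite limg_span; apply/span_subvP => _ /mapP[_ /allpairsP[[u w] /= [_ wU ->]] ->].
  by rewrite slice_pure memvZ // vbasis_mem.
have <- : slice (comul H h) = shift x h.
  rewrite /= fun_comulE linear_sum /=.
  under eq_bigr do rewrite slice_pure ffunE eq_sym.
  rewrite (bigD1 x) //= eqxx scale1r big1 ?addr0 // => y yx.
  by rewrite (negPf yx) scale0r.
by apply: (subvP sliceU); apply: memv_img; apply: (subvP sU); apply: memv_img.
Qed.

Definition ev_diff_fun x y h : k^o := h x - h y.
Lemma ev_diff_linear x y : linear (ev_diff_fun x y).
Proof.
move=> c g h; rewrite /ev_diff_fun !funAlgDE !funAlgZE scalerBr.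
by rewrite opprD addrACA.
Qed.
HB.instance Definition _ x y :=
  GRing.isLinear.Build k H k^o *:%R (ev_diff_fun x y) (ev_diff_linear x y).

(** [U] does not separate [x] and [y]; the inclusion of subspaces makes this a
    boolean although [U] may be infinite. *)
Definition same_values U x y := (U <= lker (linfun (ev_diff_fun x y)))%VS.

Lemma same_valuesP U x y :
  reflect (forall u, u \in U -> u x = u y) (same_values U x y).
Proof.
apply: (iffP subvP) => sU u /sU; rewrite memv_ker lfunE /= subr_eq0.
  by move/eqP.
by move=> ->.
Qed.

Lemma not_same_values U x y :
  ~~ same_values U x y -> exists2 u, u \in U & u x != u y.
Proof.
by case/subvPn => u uU; rewrite memv_ker lfunE /= subr_eq0; exists u.
Qed.

(** A Stone-Weierstrass theorem for finite sets: [h] is interpolated by an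
    element of [U] on larger and larger lists of points. *)
Lemma subalg_memP U h : 1 \in U -> (U * U <= U)%VS ->
  reflect (forall x y, same_values U x y -> h x = h y) (h \in U).
Proof.
move=> U1 /prodvP UM; apply: (iffP idP) => [hU x y /same_valuesP|hs]; first exact.
suff [u uU uh]: exists2 u, u \in U & {in enum A, forall x, u x = h x}.
  suff -> : h = u by [].
  by apply/ffunP => x; rewrite uh // mem_enum.
elim: (enum A) => [|p s [u uU us]]; first by exists 0; rewrite ?mem0v.
have [/hasP[q qs pq]|/hasPn sep] := boolP (has (same_values U p) s).
  exists u => // x /[!inE] /predU1P[-> |]; last exact: us.
  by rewrite (hs _ _ pq) -us //; apply/same_valuesP: uU.
(* A product of functions of [U] separating [p] from each point of [s]. *)
have [w wU [ws wp]]: exists2 w, w \in U & {in s, forall x, w x = 0} /\ w p != 0.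
  elim: s sep {us} => [|q s IHs] sep.
    by exists 1 => //; split=> //; rewrite funAlg1E oner_neq0.
  have [|w wU [ws wp]] := IHs; first by move=> x xs; rewrite sep // inE xs orbT.
  have [|v vU vpq] := @not_same_values U p q; first by rewrite sep ?inE ?eqxx.
  exists (w * (v - v q *: 1)).
    by apply: UM => //; rewrite rpredB ?memvZ.
  split=> [x|]; last first.
    by rewrite funAlgME funAlgBE funAlgZE funAlg1E mulr1 mulf_neq0 // subr_eq0.
  rewrite funAlgME inE => /predU1P[->|/ws ->]; last by rewrite mul0r.
  by rewrite funAlgBE funAlgZE funAlg1E mulr1 subrr mulr0.
exists (u + ((h p - u p) / w p) *: w); first by rewrite rpredD ?memvZ.
move=> x /[!inE] /predU1P[->|xs]; rewrite funAlgDE funAlgZE.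
  by rewrite divfK // addrC subrK.
by rewrite us // (ws x xs : w x = 0 :> k) mulr0 addr0.
Qed.

(** By translation, the points that a sub-Hopf algebra does not separate are
    the cosets of the subgroup of the points not separated from 0. *)
Lemma same_values_sub0 U x y : is_sub_hopf U ->
  same_values U x y = same_values U (x - y) 0.
Proof.
move=> sU; apply/same_valuesP/same_valuesP => same u uU.
  have := same _ (sub_hopf_shift (- y) sU uU).
  by rewrite !ffunE addNr addrC.
have := same _ (sub_hopf_shift y sU uU).
by rewrite !ffunE addr0 addrC subrK.
Qed.

Lemma sub_hopf_le U V : is_sub_hopf U -> is_sub_hopf V ->
  (forall x, same_values V x 0 -> same_values U x 0) -> (U <= V)%VS.
Proof.
move=> sU sV VU; apply/subvP => h hU.
have [V1 VM _ _] := and4P sV; have [U1 UM _ _] := and4P sU.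
apply: (introT (subalg_memP h V1 VM)) => x y.
rewrite (same_values_sub0 _ _ sV) => /VU.
rewrite -(same_values_sub0 _ _ sU).
exact: (elimT (subalg_memP h U1 UM)).
Qed.

Variable B : pred A.

Definition invariants : {vspace H} :=
  (\bigcap_(x | B x) lker (linfun (shift x : H -> H) - \1%VF))%VS.

Lemma invariantsP h :
  reflect (forall x, B x -> shift x h = h) (h \in invariants).
Proof.
rewrite memvE; apply: (iffP subv_bigcapP) => inv_h x /inv_h.
  by rewrite -memvE memv_ker add_lfunE opp_lfunE id_lfunE lfunE subr_eq0 => /eqP.
move=> hx; rewrite -memvE memv_ker add_lfunE opp_lfunE id_lfunE lfunE.
by rewrite /= hx subrr.
Qed.

Lemma invariants_sub_hopf : is_sub_hopf invariants.
Proof.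
apply/and4P; split.
- by apply/invariantsP => x _; apply: shift1.
- apply/prodvP => g h /invariantsP gI /invariantsP hI.
  by apply/invariantsP => x Bx; rewrite shiftM gI ?hI.
- apply/subvP => _ /memv_imgP[h hI ->]; rewrite /= fun_comulE.
  have shI x : shift x h \in invariants.
    move/invariantsP in hI; apply/invariantsP => y By.
    by rewrite shiftD addrC -shiftD hI.
  (* In a basis of the invariant functions, the coordinates of [shift x h] are
     themselves invariant functions of [x]. *)
  pose cf i : H := [ffun x => coord (vbasis invariants) i (shift x h)].
  have -> : \sum_x tpure (delta k x) (shift x h) =
      \sum_i tpure (cf i) (vbasis invariants)`_i.
    transitivity (\sum_x \sum_i coord (vbasis invariants) i (shift x h) *:
        tpure (delta k x) (vbasis invariants)`_i).
      apply: eq_bigr => x _; rewrite {1}(coord_vbasis (shI x)).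
      rewrite tpure_sumr; apply: eq_bigr => i _.
      by rewrite tpureZr.
    rewrite exchange_big; apply: eq_bigr => i _ /=.
    rewrite -[cf i]sum_delta tpure_suml.
    by apply: eq_bigr => x _; rewrite tpureZl ffunE.
  apply: memv_suml => i _; apply: mem_tsub; last first.
    by apply: vbasis_mem; apply: mem_nth; rewrite size_tuple.
  apply/invariantsP => y By; apply/ffunP => x; rewrite !ffunE.
  by rewrite addrC -shiftD (invariantsP _ hI).
- apply/subvP => _ /memv_imgP[h /invariantsP hI ->]; apply/invariantsP => x Bx.
  apply/ffunP => y; rewrite ffunE !fun_antipodeE.
  by rewrite -{1}(hI x Bx) ffunE opprD addrA subrr add0r.
Qed.

Lemma same_values_invariants x : B 0 ->
    (forall x y, B x -> B y -> B (x + y)) -> (forall x, B x -> B (- x)) ->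
  same_values invariants x 0 = B x.
Proof.
move=> B0 BD BN; apply/same_valuesP/idP => [same|Bx h /invariantsP /(_ x Bx) hx].
  pose ind : H := [ffun y => (B y)%:R].
  have indI : ind \in invariants.
    apply/invariantsP => y By; apply/ffunP => z; rewrite !ffunE.
    congr (nat_of_bool _)%:R; apply/idP/idP => [Byz|]; last exact: BD.
    by rewrite -[z](addKr y) BD ?BN.
  move/eqP: (same _ indI); rewrite !ffunE B0.
  by case: (B x) => //; rewrite eq_sym oner_eq0.
by rewrite -[in RHS]hx ffunE addr0.
Qed.

End SubHopf.

(** * The Galois correspondence of a graded field *)

Section Correspondence.
Variables (A : finZmodType) (k : fieldType) (K : fieldExtType k) (b : A -> K).
Hypothesis b_basis : basis_of {:K} (codom b).
Hypothesis b0 : b 0 = 1.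
Hypothesis bM : forall x y, exists c, b x * b y = c *: b (x + y).
Local Notation HG := (gradedHGS b_basis b0 bM).

Lemma gcoef_act (h : HG) x v : gcoef b x (hgs_act HG h v) = h x * gcoef b x v.
Proof.
rewrite /= gactE /gcoef linear_sum /= -/(gcoef b x v).
rewrite (bigD1 x) //= linearZ /= -/(gcoef b x (b x)) gcoef_basis // eqxx mulr1.
rewrite big1 ?addr0 // => y yx.
by rewrite linearZ /= -/(gcoef b x (b y)) gcoef_basis // eq_sym (negPf yx) mulr0.
Qed.

(** [h] acts on the component of degree [x] as [h x], and the counit is
    [h 0]. *)
Lemma mem_fixed_graded (U : {vspace HG}) v :
  reflect (forall x, gcoef b x v != 0 -> same_values U x 0)
          (v \in fixed_vspace U).
Proof.
apply: (iffP (fixed_vspaceP _ _)) => [fixv x vx|same h hU].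
  apply/same_valuesP => h hU; apply: (mulIf vx).
  by rewrite -gcoef_act fixv //= fun_counitE /gcoef linearZ.
rewrite [LHS](gactE _) [in RHS](gcoef_sum b_basis v) scaler_sumr.
apply: eq_bigr => x _; rewrite scalerA /= fun_counitE.
have [->|vx] := eqVneq (gcoef b x v) 0; first by rewrite !mulr0.
by rewrite (same_valuesP _ _ _ (same x vx)).
Qed.

Lemma basis_mem_fixed (U : {vspace HG}) x :
  (b x \in fixed_vspace U) = same_values U x 0.
Proof.
apply/mem_fixed_graded/idP => [/(_ x)|same y].
  by rewrite gcoef_basis // eqxx oner_eq0; apply.
by rewrite gcoef_basis //; case: (y =P x) => [->|_] //; rewrite eqxx.
Qed.

Hypothesis subfield_graded : forall (F : {subfield K}) v x,
  v \in F -> gcoef b x v != 0 -> b x \in F.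

(** The inverse sends a field [F] to the functions invariant under the subgroup
    of the degrees [x] with [b x] in [F]. *)
Theorem graded_correspondence_bijective :
  bijective (@galois_correspondence k K HG).
Proof.
pose Bof (F : {subfield K}) := [pred x | b x \in F].
pose inv (F : {subfield K}) : sub_hopf HG := Sub _ (invariants_sub_hopf k (Bof F)).
have fixed_inv F x : same_values (invariants k (Bof F)) x 0 = (b x \in F).
  rewrite same_values_invariants //= => [|y z|y].
  - by rewrite b0 mem1v.
  - move=> yF zF; have [c bc] := bM y z.
    have c0 : c != 0.
      apply: contra_eq_neq bc => ->.
      by rewrite scale0r mulf_neq0 ?graded_basis_neq0.
    by rewrite -(scalerK c0 (b _)) -bc memvZ // rpredM.
  - move=> yF; have [c] := bM y (- y); rewrite subrr b0 => bc.
    have -> : b (- y) = (b y)^-1 * c%:A by rewrite -bc mulKf ?graded_basis_neq0.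
    by rewrite rpredM ?rpredV // memvZ // mem1v.
exists inv => [U|F].
  apply: val_inj; apply/eqP; rewrite eqEsubv.
  have sI := valP (inv (galois_correspondence U)); have sU := valP U.
  apply/andP; split; apply: sub_hopf_le => // x; rewrite fixed_inv.
    by rewrite -(basis_mem_fixed (val U)).
  by rewrite -(basis_mem_fixed (val U)).
apply: val_inj; apply/vspaceP => v; rewrite /=.
apply/mem_fixed_graded/idP => [same|vF x vx]; last first.
  by rewrite fixed_inv; apply: subfield_graded vx.
rewrite (gcoef_sum b_basis v); apply: memv_suml => x _.
have [->|vx] := eqVneq (gcoef b x v) 0; first by rewrite scale0r mem0v.
by rewrite memvZ // -fixed_inv same.
Qed.

End Correspondence.

(** * Radical extensions *)

Section Norm.
Variables (k : fieldType) (K : fieldExtType k) (C : closedFieldType).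
Variable f : {rmorphism K -> C}.

(** [e] is the norm of [a] from [F(a)] to [F]: over an algebraically closed field
    it is a product of [adjoin_degree F a] roots of [X^n - a^n]. *)
Lemma radical_norm (F : {subfield K}) (a : K) n : a ^+ n \in F ->
  exists2 e, e \in F & e ^+ n = (a ^+ n) ^+ adjoin_degree F a.
Proof.
move=> anF; set m := adjoin_degree F a; set p := minPoly F a.
exists ((-1) ^+ m * p`_0).
  by rewrite rpredM ?rpredX ?rpredN ?mem1v // (polyOverP (minPolyOver F a)).
have [r Dp] := closed_field_poly_normal (map_poly f p).
have mon_p : map_poly f p \is monic by rewrite map_monic monic_minPoly.
rewrite (monicP mon_p) scale1r in Dp.
have size_r : size r = m.
  by apply: succn_inj; rewrite -size_minPoly -/p -(size_map_poly f) Dp size_prod_XsubC.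
have root_r z : z \in r -> z ^+ n = f (a ^+ n).
  rewrite -root_prod_XsubC -Dp => pz.
  have : minPoly F a %| 'X^n - (a ^+ n)%:P.
    apply: minPoly_dvdp; last by rewrite rootE !hornerE subrr.
    by rewrite rpredB ?rpredX ?polyOverX ?polyOverC.
  rewrite -(dvdp_map f) => /dvdpP[q /(congr1 (horner^~ z))].
  rewrite rmorphB /= map_polyXn map_polyC hornerM (rootP pz) mulr0 !hornerE.
  by rewrite ?hornerXn => /eqP; rewrite subr_eq0 => /eqP.
apply: (fmorph_inj f); rewrite !rmorphXn rmorphM rmorphXn rmorphN1.
rewrite -coef_map /= Dp coef0_prod_XsubC size_r mulrA -expr2 sqrr_sign mul1r.
rewrite -size_r -prodrXl (eq_big_seq _ root_r) big_const_seq count_predT.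
by rewrite iter_mulr_1 rmorphXn.
Qed.

End Norm.

Section Radical.
Variables (k : fieldType) (K : fieldExtType k) (C : closedFieldType).
Variables (f : {rmorphism K -> C}) (n : nat) (a : K).
Hypothesis a0 : a != 0.
Hypothesis a_gen : <<1; a>>%VS = {:K}%VS.
Hypothesis dimK : \dim {:K} = n.+1.
Hypothesis a_rad : a ^+ n.+1 \in 1%VS.

(** The norm of [a] over [F] and [a ^+ m], with [m = adjoin_degree F a], have the
    same [n.+1]-th power, so their quotient is in [k] and [a ^+ m] is in [F].
    The degree of [a] over [k(a ^+ m)] is at most [m], its degree over [F], so
    the two fields agree. *)
Lemma radical_subfieldE (F : {subfield K}) :
    (forall u : K, u ^+ n.+1 = 1 -> u \in 1%VS) ->
  F = <<1; a ^+ adjoin_degree F a>>%VS :> {vspace K}.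
Proof.
move=> roots1; set m := adjoin_degree F a.
have amF : a ^+ m \in F.
  have [e eF en] := radical_norm f (subvP (sub1v F) _ a_rad).
  have am0 : a ^+ m != 0 by rewrite expf_neq0.
  have /roots1 u1 : (e / a ^+ m) ^+ n.+1 = 1.
    by rewrite expr_div_n en -/m exprAC divff // !expf_neq0.
  have e0 : e != 0.
    by apply: contra_eq_neq en => ->; rewrite expr0n /= eq_sym !expf_neq0.
  have -> : a ^+ m = e * (e / a ^+ m)^-1 by rewrite invf_div mulrC divfK.
  by rewrite rpredM // rpredV (subvP (sub1v F)).
have F0F : (<<1; a ^+ m>> <= F)%VS by apply/FadjoinP; rewrite sub1v.
apply/esym/eqP; rewrite eqEdim F0F /=.
have full (E : {subfield K}) : <<E; a>>%VS = {:K}%VS.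
  by apply/eqP; rewrite eqEsubv subvf -a_gen adjoinSl // sub1v.
have m_gt0 : (0 < m)%N by [].
rewrite -(leq_pmul2l m_gt0) -dim_Fadjoin full -(full <<1; a ^+ m>>%AS) dim_Fadjoin.
rewrite leq_mul2r; apply/orP; right.
rewrite -ltnS -size_minPoly -(size_XnsubC (a ^+ m) m_gt0).
apply: dvdp_leq; first by rewrite -size_poly_eq0 size_XnsubC.
apply: minPoly_dvdp; last by rewrite rootE !hornerE subrr.
by rewrite rpredB ?rpredX ?polyOverX ?polyOverC ?memv_adjoin.
Qed.

(** The group structure of ['I_n.+1] is addition modulo [n.+1], so the powers of
    [a] form a graded basis because [a ^+ n.+1] is a scalar. *)
Definition powers (i : 'I_n.+1) : K := a ^+ i.

Lemma powers_basis : basis_of {:K} (codom powers).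
Proof.
rewrite basisEdim size_codom card_ord dimK leqnn andbT.
apply/subvP => v; rewrite -a_gen => va; rewrite -(Fadjoin_poly_eq va) horner_coef.
have degn : (size (Fadjoin_poly 1 a v) <= n.+1)%N.
  apply: leq_trans (size_Fadjoin_poly _ _ _) _.
  by rewrite adjoin_degreeE a_gen dimK dimv1 divn1.
apply: memv_suml => i _.
have /vlineP[c ->] := polyOverP (Fadjoin_polyOver 1 a v) i.
rewrite -scalerAl mul1r memvZ // memv_span //.
exact: (codom_f powers (widen_ord degn i)).
Qed.

Lemma powers0 : powers 0 = 1. Proof. by rewrite /powers expr0. Qed.

Lemma radical_power_mod i : exists c : k, a ^+ i = c *: powers (inord (i %% n.+1)).
Proof.
have /vlineP[c ac] := a_rad; exists (c ^+ (i %/ n.+1)).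
rewrite /powers inordK ?ltn_mod // {1}(divn_eq i n.+1) exprD mulnC exprM ac.
by rewrite exprZn expr1n -scalerAl mul1r.
Qed.

Lemma powersM (x y : 'I_n.+1) : exists c, powers x * powers y = c *: powers (x + y).
Proof.
rewrite /powers -exprD; have [c ->] := radical_power_mod (x + y); exists c.
by congr (_ *: powers _); apply: val_inj; rewrite /= inordK ?ltn_mod.
Qed.

Lemma radical_subfield_graded (F : {subfield K}) v x :
    (forall u : K, u ^+ n.+1 = 1 -> u \in 1%VS) ->
  v \in F -> gcoef powers x v != 0 -> powers x \in F.
Proof.
move=> roots1 vF; set m := adjoin_degree F a.
have FE := radical_subfieldE F roots1; rewrite FE in vF.
have amF : a ^+ m \in F by rewrite FE memv_adjoin.
have /Fadjoin_polyP[p pk ->] := vF.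
apply: contraNT => xF; rewrite horner_coef /gcoef linear_sum.
apply/eqP; apply: big1 => i _ /=.
have /vlineP[c ->] := polyOverP pk i.
rewrite -exprM -scalerAl mul1r linearZ /=; have [d ad] := radical_power_mod (m * i).
rewrite ad linearZ /= -/(gcoef _ _ _) gcoef_basis ?powers_basis //.
case: eqP => [xE|_]; last by rewrite !mulr0.
case/negP: xF; rewrite xE.
have d0 : d != 0.
  by apply: contra_eq_neq ad => ->; rewrite scale0r expf_neq0.
by rewrite -[powers _](scalerK d0) -ad exprM; apply/memvZ/rpredX.
Qed.

Definition radicalHGS := gradedHGS powers_basis powers0 powersM.

Theorem radical_correspondence_bijective :
    (forall u : K, u ^+ n.+1 = 1 -> u \in 1%VS) ->
  bijective (@galois_correspondence k K radicalHGS).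
Proof.
move=> roots1; apply: graded_correspondence_bijective => F v x.
exact: radical_subfield_graded.
Qed.

End Radical.

Lemma rat_expn_prime (p n m : nat) (q : rat) :
  prime p -> (0 < n)%N -> q ^+ n = p%:R ^+ m -> (n %| m)%N.
Proof.
move=> p_pr n_gt0 qn.
have den0 : (denq q)%:~R != 0 :> rat by rewrite intr_eq0 denq_neq0.
have numden : numq q ^+ n = p%:Z ^+ m * denq q ^+ n.
  apply: (@intr_inj rat); rewrite rmorphM !rmorphXn /= -[p%:~R]/(p%:R) -qn.
  by rewrite -exprMn numqE.
have num0 : (0 < `|numq q|)%N.
  rewrite absz_gt0 numq_eq0; apply: contra_eq_neq qn => ->.
  by rewrite expr0n gtn_eqF // eq_sym expf_neq0 // pnatr_eq0 -lt0n prime_gt0.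
have := congr1 (fun x => logn p `|x|%N) numden.
rewrite /= abszM !abszX lognM; first last.
- by rewrite expn_gt0 absz_gt0 denq_neq0.
- by rewrite expn_gt0 prime_gt0.
rewrite !lognX /= (logn_prime p p_pr) eqxx muln1 => nm.
have := dvdn_mulr (logn p `|numq q|) (dvdnn n); rewrite nm.
by rewrite dvdn_addl // dvdn_mulr.
Qed.

Section RadicalOverRat.
Variables (L : splittingFieldType rat) (f : {rmorphism L -> algC}).
Variables (p n : nat) (a : L).
Hypotheses (p_pr : prime p) (n_gt0 : (0 < n)%N) (an : a ^+ n = p%:R).

Lemma radical_over1 : 'X^n - (p%:R)%:P \is a @polyOver L 1%VS.
Proof. by rewrite rpredB ?polyOverC ?rpred_nat // rpredX // polyOverX. Qed.

Lemma minPoly_radical_dvd : minPoly 1 a %| 'X^n - (p%:R)%:P.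
Proof.
apply: (minPoly_dvdp (K := 1%AS)) radical_over1 _.
by rewrite rootE !hornerE an subrr.
Qed.

(** The norm of [a] is a rational number whose [n]-th power is [p ^ m], with
    [m] the degree of [a]: the [p]-adic valuation shows that [n] divides [m]. *)
Lemma radical_degree : adjoin_degree 1 a = n.
Proof.
apply/eqP; rewrite eqn_leq; apply/andP; split.
  rewrite -ltnS -size_minPoly -(size_XnsubC (p%:R : L) n_gt0).
  by rewrite dvdp_leq ?minPoly_radical_dvd // -size_poly_eq0 size_XnsubC.
apply: dvdn_leq => //; set m := adjoin_degree _ _.
have a_rad : a ^+ n \in 1%VS by rewrite an rpred_nat.
have [_ /vlineP[q ->] /=] := radical_norm f a_rad.
rewrite -/m an exprZn expr1n -scaler_nat exprZn expr1n => /eqP.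
rewrite -subr_eq0 -scalerBl scaler_eq0 oner_eq0 orbF subr_eq0 => /eqP.
exact: rat_expn_prime.
Qed.

Lemma minPoly_radical : minPoly 1 a = 'X^n - (p%:R)%:P.
Proof.
apply/eqP; rewrite -eqp_monic ?monic_minPoly ?monicXnsubC //.
rewrite -dvdp_size_eqp ?minPoly_radical_dvd // size_minPoly radical_degree.
by rewrite size_XnsubC.
Qed.

Lemma radical_conjugate (b : L) : b ^+ n = p%:R -> {g : 'AEnd(L) | g a = b}.
Proof.
move=> bn; have rt : root (map_poly (\1%VF : 'End(L)) (minPoly 1 a)) b.
  rewrite (kHom_poly_id (kHom1 1 fullv) (minPolyOver 1 a)).
  by rewrite minPoly_radical rootE !hornerE bn subrr.
have h1 : kHom 1 1 (\1%VF : 'End(L)) by apply: kHom1.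
have [g gE] := kHom_to_AEnd (kHomExtendP (sub1v _) h1 rt).
by exists g; rewrite -gE ?memv_adjoin // (kHomExtend_val h1 rt).
Qed.

End RadicalOverRat.

(** * Simple subextensions as extensions in their own right *)

Section SimpleExt.
Variables (k : fieldType) (L : fieldExtType k) (a : L).

Definition simpleExt := subvs_of <<1; a>>%AS.
Definition simple_gen : simpleExt := Subvs (memv_adjoin 1%AS a).
Definition simple_incl : 'AHom(simpleExt, L) :=
  linfun_ahom (vsval : {lrmorphism simpleExt -> L}).

Lemma simple_inclE v : simple_incl v = vsval v.
Proof. exact: lfunE. Qed.

Lemma limg_simple_incl : limg simple_incl = <<1; a>>%VS.
Proof.
apply/vspaceP => x; apply/memv_imgP/idP => [[v _ ->]|xE].
  by rewrite simple_inclE subvsP.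
by exists (Subvs xE); rewrite ?memvf // simple_inclE.
Qed.

Lemma dim_simpleExt : \dim {:simpleExt} = adjoin_degree 1 a.
Proof. by rewrite dimvf /dim /= dim_Fadjoin dimv1 muln1. Qed.

Lemma simple_gen_full : <<1; simple_gen>>%VS = {:simpleExt}%VS.
Proof.
apply/eqP; rewrite eqEdim subvf dim_simpleExt /= dim_Fadjoin dimv1 muln1.
by rewrite -(adjoin_degree_aimg simple_incl) aimg1 simple_inclE.
Qed.

End SimpleExt.

Lemma simpleExt_fixed (k : fieldType) (L : fieldExtType k) (a : L)
    (g : 'AEnd(L)) (v : simpleExt a) : g a = a -> g (vsval v) = vsval v.
Proof.
move=> ga; apply/fixedSpaceP; apply: (subvP _ _ (subvsP v)).
by apply/FadjoinP; split; [apply: sub1v | apply/fixedSpaceP].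
Qed.

Lemma separable_rat (K : fieldExtType rat) (U V : {subfield K}) : separable U V.
Proof.
apply/separableP => y _; apply: pcharf0_separable => p.
by rewrite (fmorph_pchar (in_alg K)) pchar_num.
Qed.

(** * Squares and normal complements *)

(** Since [G / M] is a quotient of [H], it has exponent 2 and [M] contains the
    squares of [G]. *)
Lemma normal_complement_sqr (gT : finGroupType) (G H M : {group gT}) (g : gT) :
    (M <| G)%g -> (M :&: H = 1)%g -> (M * H = G)%g ->
    (forall h, h \in H -> h * h = 1)%g ->
  g \in G -> (g * g \in H)%g -> (g * g = 1)%g.
Proof.
move=> nMG MH1 MHG Hsq gG ggH; suff ggM : (g * g)%g \in M.
  by apply/set1P; rewrite -[[set 1%g]]MH1 inE ggM.
have /mulsgP[m h mM hH gE] : g \in (M * H)%g by rewrite MHG.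
have hG : h \in G by rewrite -MHG -[h]mul1g mem_mulg.
have -> : (g * g = m * m ^ h^-1)%g.
  rewrite gE conjgE invgK !mulgA; congr (_ * _)%g.
  by apply/eqP; rewrite eq_sym eq_invg_mul Hsq.
by rewrite groupM // memJ_norm // (subsetP (normal_norm nMG)) // groupV.
Qed.

(** * The extension generated by a tenth root of 5 *)

Section TenthRoot.
Variables (L : splittingFieldType rat) (f : {rmorphism L -> algC}) (a w : L).
Hypothesis a10 : a ^+ 10 = 5%:R.
Hypothesis w_prim : 5.-primitive_root w.
Hypothesis L_gen : <<1 & [:: a; w]>>%VS = {:L}%VS.

Let natL_eq0 n : (n%:R == 0 :> L) = (n == 0)%N.
Proof. by rewrite -(fmorph_eq0 f) rmorph_nat pnatr_eq0. Qed.

Lemma tenth_root_neq0 : a != 0.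
Proof. by move: (natL_eq0 5); rewrite -a10 expf_eq0 /= => ->. Qed.

Let w5 : w ^+ 5 = 1. Proof. exact: prim_expr_order w_prim. Qed.

Let wX m : w ^+ (5 + m) = w ^+ m. Proof. by rewrite exprD w5 mul1r. Qed.

Let sum_w : 1 + w + w ^+ 2 + w ^+ 3 + w ^+ 4 = 0.
Proof.
have w1 : w - 1 != 0 by rewrite subr_eq0 -[w]expr1 -(prim_order_dvd w_prim).
apply: (mulfI w1); rewrite mulr0.
have -> : (w - 1) * (1 + w + w ^+ 2 + w ^+ 3 + w ^+ 4) = w ^+ 5 - 1 by ring.
by rewrite w5 subrr.
Qed.

(** The quadratic Gauss sum modulo 5. *)
Definition sqrt5 : L := 1 + 2%:R * (w + w ^+ 4).

Lemma sqrt5_sqr : sqrt5 ^+ 2 = 5%:R.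
Proof.
apply/eqP; rewrite -subr_eq0; apply/eqP.
have -> : sqrt5 ^+ 2 - 5%:R = 4%:R * (1 + w + w ^+ 2 + w ^+ 3 + w ^+ 4)
   + (8%:R + 4%:R * w ^+ 3) * (w ^+ 5 - 1) by rewrite /sqrt5; ring.
by rewrite sum_w w5 subrr !mulr0 addr0.
Qed.

Lemma tenth_root_sqrt5 : a ^+ 5 = sqrt5 \/ a ^+ 5 = - sqrt5.
Proof.
have /eqP : (a ^+ 5) ^+ 2 = sqrt5 ^+ 2 by rewrite -exprM a10 sqrt5_sqr.
by rewrite eqf_sqr => /orP[/eqP|/eqP]; [left|right].
Qed.

Lemma sqrt5_neqN : sqrt5 <> - sqrt5.
Proof.
move/eqP; rewrite -subr_eq0 opprK -mulr2n -mulr_natr mulf_eq0 natL_eq0 orbF.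
by move: (natL_eq0 5); rewrite -sqrt5_sqr expf_eq0 /= => ->.
Qed.

(** The quadratic character modulo 5: [w ^+ j] and [w ^+ (5 - j)] have the same
    sum, and the two sums of this kind add up to - 1. *)
Lemma aut_root5 (g : 'AEnd(L)) :
  [\/ g w = w /\ g sqrt5 = sqrt5, g w = w ^+ 4 /\ g sqrt5 = sqrt5,
      g w = w ^+ 2 /\ g sqrt5 = - sqrt5 | g w = w ^+ 3 /\ g sqrt5 = - sqrt5].
Proof.
have [|i gw] := prim_rootP w_prim (x := g w).
  by rewrite -rmorphXn w5 rmorph1.
have gw1 : g w != 1 by rewrite fmorph_eq1 -[w]expr1 -(prim_order_dvd w_prim).
have gt : g sqrt5 = 1 + 2%:R * (g w + g w ^+ 4).
  by rewrite rmorphD rmorph1 rmorphM rmorph_nat rmorphD rmorphXn.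
have sqrt5N : 1 + 2%:R * (w ^+ 2 + w ^+ 3) = - sqrt5.
  apply/eqP; rewrite -subr_eq0 opprK; apply/eqP.
  have -> : 1 + 2%:R * (w ^+ 2 + w ^+ 3) + sqrt5 =
     2%:R * (1 + w + w ^+ 2 + w ^+ 3 + w ^+ 4) by rewrite /sqrt5; ring.
  by rewrite sum_w mulr0.
move: gt gw1; rewrite gw; case: i {gw} => [[|[|[|[|[|//]]]]] /= _];
  rewrite -?exprM => gt gw1.
- by rewrite expr0 eqxx in gw1.
- by constructor 1; rewrite gt.
- by constructor 3; rewrite gt (wX 3).
- by constructor 4; rewrite gt (wX 7) (wX 2) [w ^+ 3 + _]addrC.
- by constructor 2; rewrite gt (wX 11) (wX 6) (wX 1) /sqrt5 [w + _]addrC.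
Qed.

(** [h] fixes [a ^+ 5], a square root of 5, so it raises [w] to the power 1
    or -1. *)
Lemma aut_fixing_tenth_root (h : 'AEnd(L)) : h a = a -> h (h w) = w.
Proof.
move=> ha; have ht : h sqrt5 = sqrt5.
  have ha5 : h (a ^+ 5) = a ^+ 5 by rewrite rmorphXn /= ha.
  case: tenth_root_sqrt5 => a5; rewrite a5 ?rmorphN /= in ha5 => //.
  exact: oppr_inj ha5.
case: (aut_root5 h) => [] [hw ht'].
- by rewrite !hw.
- by rewrite hw rmorphXn /= hw -exprM (wX 11) (wX 6) (wX 1).
- by case: sqrt5_neqN; rewrite -ht' ht.
- by case: sqrt5_neqN; rewrite -ht' ht.
Qed.

(** [g] changes the sign of [a ^+ 5], so it raises [w] to a power which is not a
    square modulo 5; the square of that power is -1. *)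
Lemma aut_negating_tenth_root (g : 'AEnd(L)) :
  g a = - a -> g (g a) = a /\ g (g w) = w ^+ 4.
Proof.
move=> ga; split; first by rewrite ga rmorphN /= ga opprK.
have gt : g sqrt5 = - sqrt5.
  have ga5 : g (a ^+ 5) = - a ^+ 5 by rewrite rmorphXn /= ga; ring.
  case: tenth_root_sqrt5 => a5; rewrite a5 ?rmorphN /= in ga5 => //.
  exact: oppr_inj ga5.
case: (aut_root5 g) => [] [gw gt'].
- by case: sqrt5_neqN; rewrite -gt -{1}gt'.
- by case: sqrt5_neqN; rewrite -gt -{1}gt'.
- by rewrite gw rmorphXn /= gw -exprM.
- by rewrite gw rmorphXn /= gw -exprM (wX 4).
Qed.

Lemma aut_eq_id (g : 'AEnd(L)) v : g a = a -> g w = w -> g v = v.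
Proof.
move=> ga gw; apply/fixedSpaceP; apply: (subvP _ _ (memvf v)).
rewrite -L_gen; apply/Fadjoin_seqP; split; first exact: sub1v.
by move=> x; rewrite !inE => /orP[] /eqP ->; apply/fixedSpaceP.
Qed.

Lemma negating_aut : {g : 'AEnd(L) | g a = - a}.
Proof.
apply: (radical_conjugate f (isT : prime 5) (isT : 0 < 10)%N a10).
by rewrite -a10; ring.
Qed.

Local Notation K := (simpleExt a).

Lemma dim_tenth_root : \dim {:K} = 10%N.
Proof. by rewrite dim_simpleExt (radical_degree f (isT : prime 5) _ a10). Qed.

Lemma tenth_root_radical : simple_gen a ^+ 10 \in 1%VS.
Proof.
have -> : simple_gen a ^+ 10 = 5%:R.
  apply: (fmorph_inj (vsval : {rmorphism K -> L})).
  by rewrite rmorphXn rmorph_nat -a10.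
exact: rpred_nat.
Qed.

Lemma simple_gen_neq0 : simple_gen a != 0.
Proof. by apply: contra_neq tenth_root_neq0 => /(congr1 vsval). Qed.

(** The square of a tenth root of unity of [K] is a power of [w] which is both
    fixed and inverted by the square of the automorphism [a |-> - a]. *)
Lemma tenth_root_unity (u : K) : u ^+ 10 = 1 -> u \in 1%VS.
Proof.
move=> u10; have [g ga] := negating_aut.
have [gga ggw] := aut_negating_tenth_root ga.
have val_u10 : vsval u ^+ 2 ^+ 5 = 1 by rewrite -exprM -rmorphXn u10 rmorph1.
have [i u2] := prim_rootP w_prim val_u10.
have := simpleExt_fixed (g := (g \o g)%AF) (u ^+ 2).
rewrite comp_lfunE => /(_ gga).
rewrite rmorphXn /= u2 comp_lfunE !rmorphXn /= ggw -exprM => /eqP.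
rewrite (eq_prim_root_expr w_prim) => i0.
have {}i0 : i = 0 :> nat by move: i0; case: i {u2} => [[|[|[|[|[|]]]]]].
have : u ^+ 2 == 1.
  apply/eqP/(fmorph_inj (vsval : {rmorphism K -> L})).
  by rewrite rmorphXn rmorph1 /= u2 i0.
by rewrite sqrf_eq1 => /orP[] /eqP ->; rewrite ?rpredN mem1v.
Qed.

(** A normal extension of [Q] containing [a] also contains its conjugate
    [w * a], hence [w]. *)
Lemma tenth_root_galois_closure : galois_closure (simple_incl a).
Proof.
split=> [|M].
  by apply/and3P; split; [apply: sub1v | apply: separable_rat | apply: normalFieldf].
rewrite limg_simple_incl => /FadjoinP[_ aM] /and3P[_ _ /forall_inP normM].
apply: val_inj; apply/eqP; rewrite /= eqEsubv subvf -L_gen.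
apply/Fadjoin_seqP; split; first exact: sub1v.
have wM : w \in M.
  have [g ga] : {g : 'AEnd(L) | g a = w * a}.
    apply: (radical_conjugate f (isT : prime 5) (isT : 0 < 10)%N a10).
    by rewrite exprMn (exprM w 5 2) w5 expr1n mul1r.
  have waM : w * a \in M.
    rewrite -ga -(eqP (normM g _)) ?memv_img //.
    by rewrite inE kAutfE k1AHom.
  by rewrite -[w](mulfK tenth_root_neq0) rpredM ?rpredV.
by move=> x; rewrite !inE => /orP[] /eqP ->.
Qed.

(** The elements of the group of [L] over [Q(a)] have square 1, but the square of
    the automorphism [a |-> - a] is a nontrivial one. *)
Lemma tenth_root_not_almost_classical :
  ~ almost_classically_galois (simple_incl a).
Proof.
case=> M []; rewrite limg_simple_incl => nM MG' GE.
have [g0 g0a] := negating_aut; have [gga ggw] := aut_negating_tenth_root g0a.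
pose g := gal {:L} g0.
have gE v : g v = g0 v by apply: galK; rewrite ?subvf ?memvf.
have sqE (x : gal_of {:L}) v : (x * x)%g v = x (x v) by rewrite galM ?memvf.
have gg1 : (g * g = 1)%g.
  apply: normal_complement_sqr nM MG' GE _ _ _ => [h hG'||].
  - have ha : h a = a.
      by apply: (fixed_gal (subvf _) hG'); apply: memv_adjoin.
    apply/eqP/gal_eqP => v _; rewrite gal_id.
    by apply: aut_eq_id; rewrite sqE ?aut_fixing_tenth_root // !ha.
  - by rewrite gal_kHom ?sub1v ?k1AHom.
  - rewrite gal_kHom ?subvf //; apply/kAHomP => v vE.
    by apply: (simpleExt_fixed (Subvs vE)); rewrite sqE !gE.
have : w ^+ 4 == w ^+ 1 by rewrite expr1 -ggw -!gE -sqE gg1 gal_id.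
by rewrite (eq_prim_root_expr w_prim).
Qed.

End TenthRoot.

Lemma tenth_root_splitting_field :
  {L : splittingFieldType rat & {f : {rmorphism L -> algC} & {aw : L * L |
    [/\ aw.1 ^+ 10 = 5%:R, 5.-primitive_root aw.2
      & <<1 & [:: aw.1; aw.2]>>%VS = {:L}%VS]}}}.
Proof.
have [zC zC_prim] := C_prim_root_exists (isT : 0 < 10)%N.
have [L [f [[|a [|z [|//]]] // [fa fz] L_gen]]] :=
  num_field_exists [:: (10.-root 5%:R : algC); zC].
have a10 : a ^+ 10 = 5%:R.
  by apply: (fmorph_inj f); rewrite rmorphXn rmorph_nat /= fa rootCK.
have z_prim : 10.-primitive_root z by rewrite -fz fmorph_primitive_root in zC_prim.
have a0 : a != 0.
  have : 5%:R != 0 :> L by rewrite -(fmorph_eq0 f) rmorph_nat pnatr_eq0.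
  by rewrite -a10 expf_eq0.
pose r := [seq z ^+ i * a | i <- iota 0 10].
have uniq_r : uniq r.
  rewrite map_inj_in_uniq ?iota_uniq // => i j; rewrite !mem_iota /= => i10 j10.
  move/(mulIf a0)/eqP; rewrite (eq_prim_root_expr z_prim) !modn_small //.
  by move/eqP.
have splitL : FieldExt_isSplittingField _ L.
  constructor; exists ('X^10 - 5%:R%:P).
    by rewrite rpredB ?polyOverC ?rpred_nat // rpredX // polyOverX.
  exists r.
    have -> : 'X^10 - 5%:R%:P = \prod_(y <- r) ('X - y%:P).
      have roots_r : all (root ('X^10 - (5%:R : L)%:P)) r.
        apply/allP => _ /mapP[i _ ->]; rewrite rootE !hornerE exprMn exprAC.
        by rewrite (prim_expr_order z_prim) expr1n mul1r a10 subrr.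
      rewrite (all_roots_prod_XsubC _ roots_r) ?uniq_rootsE ?size_XnsubC //.
      by rewrite (monicP (monicXnsubC _ _)) // scale1r.
    exact: eqpxx.
  apply/eqP; rewrite eqEsubv subvf -L_gen; apply/Fadjoin_seqP.
  split; first exact: sub1v.
  have ra i : (i < 10)%N -> z ^+ i * a \in <<1 & r>>%VS.
    by move=> i10; apply/seqv_sub_adjoin/mapP; exists i; rewrite ?mem_iota.
  have aR : a \in <<1 & r>>%VS by rewrite -[a]mul1r (ra 0).
  move=> x; rewrite !inE => /orP[] /eqP -> //.
  by rewrite -[z](mulfK a0) rpred_div // (ra 1).
have z2_gen : <<1 & [:: a; (z ^+ 2)%R]>>%VS = {:L}%VS.
  apply/eqP; rewrite eqEsubv subvf -[X in (X <= _)%VS]L_gen.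
  apply/Fadjoin_seqP; split; first exact: sub1v.
  have z5 : z ^+ 5 = -1.
    have /eqP : z ^+ 5 ^+ 2 = 1 by rewrite -exprM (prim_expr_order z_prim).
    by rewrite sqrf_eq1 -(prim_order_dvd z_prim) /= => /eqP.
  move=> x; rewrite !inE => /orP[] /eqP ->.
    by apply: seqv_sub_adjoin; rewrite mem_head.
  have zE : z = - (z ^+ 2) ^+ 3.
    by rewrite -exprM -[(2 * 3)%N]/(5 + 1)%N exprD z5 mulN1r opprK.
  rewrite [X in X \in _]zE rpredN rpredX //.
  by apply: seqv_sub_adjoin; rewrite !inE eqxx orbT.
exists (HB.pack_for (splittingFieldType rat) L splitL), f, (a, z ^+ 2).
by split=> //; apply: (dvdn_prim_root z_prim (isT : 5 %| 10)%N).
Qed.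

Theorem corollary3p5 :
  exists (k : fieldType) (K : fieldExtType k)
         (L : splittingFieldType k) (iota : 'AHom(K, L)),
    [/\ separable 1 {:K},
        hopf_galois K,
        galois_closure iota,
        ~ almost_classically_galois iota
      & exists H : hopfGaloisStructure K,
          bijective (@galois_correspondence k K H)].
Proof.
have [L [f [[a w] /= [a10 w_prim L_gen]]]] := tenth_root_splitting_field.
exists rat, (simpleExt a), L, (simple_incl a).
pose H := radicalHGS (simple_gen_full a) (dim_tenth_root f a10)
  (tenth_root_radical a10).
split.
- exact: separable_rat.
- by constructor; exact: H.
- exact: (tenth_root_galois_closure f a10 w_prim L_gen).
- exact: (tenth_root_not_almost_classical f a10 w_prim L_gen).
exists H.
apply: (radical_correspondence_bijective (f \o (vsval : simpleExt a -> L))).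
  exact: (simple_gen_neq0 f a10).
exact: (tenth_root_unity f a10 w_prim).
Qed.
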